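(* Let $\mathcal{X}$ be a complete separable metric space with Borel sigma field $\mathcal{S}$, let $\mu$ be any probability measure on $(\mathcal{X}, \mathcal{S})$, and let $\mathcal{C} \subseteq \mathcal{S}$. If $\mathcal{C}$ is a countable VC-class, then the bracketing number $N_{[\,]}(\epsilon, \mathcal{C}, \mu)$ is finite for every $\epsilon > 0$.
   Context: A family $\mathcal{C} \subseteq \mathcal{S}$ of measurable sets is a Vapnik-Chervonenkis (VC) class if there is a finite integer $k$ such that $|\{ C \cap D : C \in \mathcal{C} \}| < 2^k$ for every $D \subseteq \mathcal{X}$ with $|D| = k$, where $|\cdot|$ denotes cardinality. For each pair of sets $A, B \in \mathcal{S}$, the bracket $[A,B]$ consists of all sets $C \subseteq \mathcal{X}$ such that $A \subseteq C \subseteq B$; if $A$ is not a subset of $B$, then $[A,B]$ is empty. The bracket $[A,B]$ is an $\epsilon$-bracket if $\mu(B \setminus A) \leq \epsilon$. The bracketing number $N_{[\,]}(\epsilon, \mathcal{C}, \mu)$ of a family $\mathcal{C} \subseteq \mathcal{S}$ is the least number of $\epsilon$-brackets needed to cover $\mathcal{C}$ (i.e. such that every $C \in \mathcal{C}$ belongs to at least one of the brackets). The sets defining the brackets need not be elements of $\mathcal{C}$. *)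

(* Defs.v *)
From HB Require Import structures.
From mathcomp Require Import all_boot all_order all_algebra.
From mathcomp Require Import all_classical all_reals all_analysis.

Set Implicit Arguments.
Unset Strict Implicit.
Unset Printing Implicit Defensive.

Import Order.TTheory GRing.Theory Num.Theory.

Local Open Scope classical_set_scope.
Local Open Scope ring_scope.
Local Open Scope card_scope.

(* [Complete] carries a point; no generality is lost as long as the space bears
   a probability measure, hence is nonempty. *)
#[short(type="completeMetricType")]
HB.structure Definition CompleteMetric (R : numDomainType) :=
  {T of Complete T & Metric R T}.

Definition separable_space (T : topologicalType) : Prop :=
  exists2 D : set T, countable D & dense D.

Notation borel T := (g_sigma_algebraType (@open T)).

Definition set_trace {T : Type} (C : set (set T)) (D : set T) : set (set T) :=
  [set A `&` D | A in C].

(* The strict bound includes the finiteness of the trace. *)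
Definition vc_class {T : Type} (C : set (set T)) : Prop :=
  exists k : nat, forall D : set T, D #= `I_k ->
    exists2 n : nat, (n < 2 ^ k)%N & set_trace C D #= `I_n.

Definition bracket {T : Type} (A B : set T) : set (set T) :=
  [set C | A `<=` C /\ C `<=` B].

Definition eps_bracket {d : measure_display} {T : measurableType d}
    {R : realType} (mu : {measure set T -> \bar R}) (eps : R)
    (b : set (set T)) : Prop :=
  exists A B : set T, [/\ measurable A, measurable B,
    (mu (B `\` A) <= eps%:E)%E & b = bracket A B].

Definition bracket_cover {d : measure_display} {T : measurableType d}
    {R : realType} (mu : {measure set T -> \bar R}) (eps : R)
    (C : set (set T)) (n : nat) : Prop :=
  exists F : set (set (set T)), [/\ F #= `I_n, F `<=` eps_bracket mu eps
    & C `<=` \bigcup_(b in F) b].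

(* A minimum in the natural numbers extended by +oo: the value is +oo exactly
   when no finite collection of brackets covers the family. *)
Definition bracketing_number {d : measure_display} {T : measurableType d}
    {R : realType} (eps : R) (C : set (set T))
    (mu : {measure set T -> \bar R}) : \bar R :=
  ereal_inf [set (n%:R)%:E | n in bracket_cover mu eps C].

(* Main.v *)
Require Import Defs.
From HB Require Import structures.
From mathcomp Require Import all_boot all_order all_algebra.
From mathcomp Require Import all_classical all_reals all_analysis.

Set Implicit Arguments.
Unset Strict Implicit.
Unset Printing Implicit Defensive.

Import Order.TTheory GRing.Theory Num.Theory.

Local Open Scope classical_set_scope.
Local Open Scope ring_scope.

(** Why the theorem holds.  Call a subfamily of [C] small if finitely many
    [eps]-brackets cover it.  Small subfamilies form an ideal, so if [C] itself
    is not small, some ultrafilter [U] on sets contains [C] and contains no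
    small subfamily ([not_finitely_bracketed_ultra]).

    Say that a measurable [B] is decided if [U]-almost every [c] contains [B]
    up to a null set, or [U]-almost every [c] misses [B] up to a null set.  Each
    of the two kinds of decided sets is stable under finite unions, hence is
    exhausted, up to null sets, by one measurable set ([ideal_ess_sup]).  The
    complement [Y] of the two exhausting sets is not null: otherwise one decided
    set of each kind would together fill the space up to measure [eps], and the
    members of [C] that treat these two sets as [U]-almost every [c] does would
    all lie in a single [eps]-bracket, after discarding a null set; the
    countability of [C] enters there, to make that null set a countable union
    ([finitely_bracketed_decided], [splitting_set]).

    No subset of [Y] of positive measure is decided, so [U]-almost every [c]
    cuts it into two pieces of positive measure.  Finitely many such sets can be
    cut by the same [c], because [U] is closed under finite intersections.
    Iterating from [Y] gives arbitrarily many members of [C] all of whose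
    Boolean atoms have positive measure ([independent_sets]).  This is
    impossible in a VC class: [2 ^ k] sets with nonempty atoms shatter [k]
    points ([vc_class_dual]). *)

(** * Independent families and the VC condition *)

Definition side {T : Type} (b : bool) (c : set T) : set T :=
  if b then c else ~` c.

(** Independent sets in a VC class are bounded in number.  Index [2 ^ k] of them
    by the subsets of a [k]-element set and choose, for each [i], a point in the
    atom of the sets whose index contains [i]: the family then cuts out every
    subset of these [k] points. *)
Lemma vc_class_dual (T : Type) (C : set (set T)) : vc_class C ->
  exists S : finType, forall c : S -> set T, (forall s, C (c s)) ->
    exists f : {ffun S -> bool}, \bigcap_s side (f s) (c s) = set0.
Proof.
move=> [k hk]; exists {ffun 'I_k -> bool} => c Cc; apply: contrapT => hne.
have /choice[x hx] : forall i : 'I_k, exists y : T,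
    forall s : {ffun 'I_k -> bool}, side (s i) (c s) y.
  move=> i; apply: contrapT => /forallNP hi; apply: hne.
  exists [ffun s : {ffun 'I_k -> bool} => s i].
  rewrite -subset0 => y hy; apply: (hi y) => s.
  by have := hy s I; rewrite ffunE.
have cE s i : c s (x i) <-> s i.
  by have := hx i s; rewrite /side; case: (s i).
(* The sets indexed by singletons separate the chosen points. *)
have xinj : injective x.
  move=> i j xij; apply/eqP.
  have : c [ffun l => l == i] (x i) by apply/cE; rewrite ffunE.
  by rewrite xij => /cE; rewrite ffunE eq_sym.
have [|n hn hcard] := hk (range x).
  have xI : (range x #= [set: 'I_k])%card by apply: inj_card_eq; exact: in2W.
  by apply: (card_eq_trans xI); rewrite card_eq_sym; exact: card_II.
pose t s := c s `&` range x.
have tinj : injective t.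
  move=> s s' ss'; apply/ffunP => i.
  have e : t s (x i) <-> t s' (x i) by rewrite ss'.
  have tE r : t r (x i) <-> r i.
    split=> [[/cE//]|ri]; split; [exact/cE|by exists i].
  by apply/idP/idP => /tE/e/tE.
have tI : (`I_(2 ^ k) #= range (t \o @enum_val _ {ffun 'I_k -> bool}))%card.
  have -> : (2 ^ k)%N = #|{ffun 'I_k -> bool}|.
    by rewrite card_ffun card_bool card_ord.
  apply: (card_eq_trans card_II); rewrite card_eq_sym; apply: inj_card_eq.
  by apply: in2W; apply: inj_comp => //; exact: enum_val_inj.
have : (`I_(2 ^ k) #<= `I_n)%card.
  rewrite (card_le_eql tI) -(card_le_eqr hcard).
  apply: subset_card_le => _ [i _ <-]; exists (c (enum_val i)) => //.
by rewrite card_le_II leqNgt hn.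
Qed.

(** * Exhausting an ideal of measurable sets *)

Section measure.
Context {d : measure_display} {T : measurableType d} {R : realType}.

Lemma negligible_bigcup_countable (mu : {measure set T -> \bar R}) (I : Type)
    (D : set I) (F : I -> set T) : countable D ->
  (forall i, D i -> mu.-negligible (F i)) ->
  mu.-negligible (\bigcup_(i in D) F i).
Proof.
move=> /pfcard_geP[->|[f]] hF.
  by rewrite bigcup_set0; exact: negligible_set0.
apply: negligibleS (_ : mu.-negligible (\bigcup_k F (f k))); last first.
  by apply: negligible_bigcup => k; apply: hF; exact: funS.
move=> x [i /(@surj _ _ _ _ f)[k _ <-] Fx].
by exists k.
Qed.

(** The essential supremum [V] is the union of a sequence of members of [J]
    whose measures approach the supremum over [J].  A member of [J] cannot stick
    out of [V] by a positive amount, since joining it to a late term of the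
    sequence would exceed that supremum.  [V] itself need not belong to [J],
    whence the approximation from inside. *)
Lemma ideal_ess_sup (mu : {finite_measure set T -> \bar R})
    (J : set (set T)) : J `<=` measurable -> J set0 ->
    (forall A B, J A -> J B -> J (A `|` B)) ->
  exists V, [/\ measurable V, forall B, J B -> mu.-negligible (B `\` V) &
    forall e : R, 0 < e ->
      exists A, [/\ J A, A `<=` V & (mu (V `\` A) <= e%:E)%E]].
Proof.
move=> Jm J0 JU.
set s := ereal_sup (mu @` J).
have sub A : J A -> (mu A <= s)%E by move=> JA; apply: ereal_sup_ubound; exists A.
have sfin : s \is a fin_num.
  rewrite ge0_fin_numE; last by rewrite -(measure0 mu); exact: sub.
  apply: (@le_lt_trans _ _ (mu setT)); last first.
    by rewrite ltey_eq fin_num_measure.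
  apply: ge_ereal_sup => _ [A JA <-].
  by apply: le_measure; rewrite ?inE//; exact: Jm.
have /choice[A hA] : forall n : nat, exists A, J A /\ (s - n.+1%:R^-1%:E < mu A)%E.
  move=> n; have n0 : 0 < (n.+1%:R^-1 : R) by rewrite invr_gt0.
  by have [_ [A JA <-] lt] := ub_ereal_sup_adherent n0 sfin; exists A.
have mA n : measurable (A n) by apply: Jm; case: (hA n).
pose V := \bigcup_n A n; have mV : measurable V by exact: bigcupT_measurable.
exists V; split => // [B JB|e e0].
  have mB := Jm _ JB.
  apply/negligibleP; first exact: measurableD.
  apply/eqP; rewrite -measure_le0; apply/lee_addgt0Pr => e e0; rewrite add0e.
  have [n] := ltr_add_invr e0; rewrite add0r => ne.
  apply: (@le_trans _ _ (mu (B `\` A n))).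
    apply: le_measure; rewrite ?inE; [exact: measurableD..|].
    by apply: setDS; exact: bigcup_sup.
  have [JAn ltAn] := hA n.
  have leS : (mu (A n) + mu (B `\` A n) <= s)%E.
    rewrite -[leLHS]measureU//; [|exact: measurableD|exact: setDIK].
    by rewrite setUDr setDv setD0; exact/sub/JU.
  have fA : mu (A n) \is a fin_num by exact: fin_num_measure.
  have fB : mu (B `\` A n) \is a fin_num.
    by apply: fin_num_measure; exact: measurableD.
  move: leS ltAn; rewrite -(fineK fA) -(fineK fB) -(fineK sfin).
  rewrite -EFinB -EFinD !lee_fin lte_fin => leS ltA.
  apply: le_trans (ltW ne); rewrite -(lerD2l (fine (mu (A n)))).
  by apply: le_trans leS _; rewrite -lerBlDr; exact: ltW.
pose W n := V `\` \big[setU/set0]_(i < n) A i.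
have mW n : measurable (W n).
  by apply: measurableD => //; exact: bigsetU_measurable.
have W0 : \bigcap_n W n = set0.
  rewrite -subset0 => x Wx.
  have [k _ Akx] := (Wx 0%N I).1.
  apply: (Wx k.+1 I).2; rewrite -bigcup_mkord.
  by exists k => /=.
have : (mu \o W) n @[n --> \oo] --> mu (\bigcap_n W n).
  apply: nonincreasing_cvg_mu => //.
  - by rewrite ltey_eq fin_num_measure.
  - by rewrite W0.
  - move=> n m nm; apply/subsetPset; apply: setDS; exact: subset_bigsetU.
rewrite W0 measure0 => hW.
have /hW [n _ /(_ n (leqnn n)) /= hn] : nbhs 0%E [set y : \bar R | (y < e%:E)%E].
  exact: (@nbhs_open_ereal_lt _ 0 (fun=> e)).
exists (\big[setU/set0]_(i < n) A i); split; last exact: ltW.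
  elim/big_ind : _ => // i _; by case: (hA i).
by apply: bigsetU_bigcup.
Qed.

(** * Families covered by finitely many brackets *)

Definition finitely_bracketed (mu : {measure set T -> \bar R}) (eps : R)
    (D : set (set T)) : Prop := exists n, bracket_cover mu eps D n.

Lemma finitely_bracketedP (mu : {measure set T -> \bar R}) eps D :
  finitely_bracketed mu eps D <-> exists F : set (set (set T)),
    [/\ finite_set F, F `<=` eps_bracket mu eps & D `<=` \bigcup_(b in F) b].
Proof.
split=> [[n [F [Fn Fe DF]]]|[F [/finite_setP[n Fn] Fe DF]]].
  by exists F; split => //; apply/finite_setP; exists n.
by exists n, F.
Qed.

Lemma finitely_bracketedS (mu : {measure set T -> \bar R}) eps D E :
  D `<=` E -> finitely_bracketed mu eps E -> finitely_bracketed mu eps D.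
Proof.
by move=> DE [n [F [Fn Fe EF]]]; exists n, F; split => // x /DE/EF.
Qed.

Lemma finitely_bracketedU (mu : {measure set T -> \bar R}) eps D E :
  finitely_bracketed mu eps D -> finitely_bracketed mu eps E ->
  finitely_bracketed mu eps (D `|` E).
Proof.
move=> /finitely_bracketedP[F [Ff Fe DF]] /finitely_bracketedP[G [Gf Ge EG]].
apply/finitely_bracketedP; exists (F `|` G); split.
- by rewrite finite_setU.
- by move=> b [/Fe|/Ge].
- by rewrite bigcup_setU; exact: setUSS.
Qed.

Lemma finitely_bracketed0 (mu : {measure set T -> \bar R}) eps :
  finitely_bracketed mu eps set0.
Proof. by apply/finitely_bracketedP; exists set0; split. Qed.

(** One bracket suffices: up to null sets every member of [D] contains [A false]
    and avoids [A true].  Countability of [D] lets the exceptional sets be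
    collected in a single null set [N], which is removed from the lower end and
    added to the upper end. *)
Lemma finitely_bracketed_decided (mu : {measure set T -> \bar R}) eps
    (D : set (set T)) (A : bool -> set T) :
  countable D -> (forall b, measurable (A b)) ->
  (forall b c, D c -> mu.-negligible (A b `&` side b c)) ->
  (mu (~` (A false `|` A true)) <= eps%:E)%E ->
  finitely_bracketed mu eps D.
Proof.
move=> Dc mA hA heps.
have [N [mN N0 hN]] : mu.-negligible
    (\bigcup_(c in D) (\bigcup_b (A b `&` side b c))).
  apply: negligible_bigcup_countable => // c Dc'.
  apply: negligible_bigcup_countable => // b _.
  exact: hA.
have NA b c x : D c -> A b x -> side b c x -> N x.
  by move=> *; apply: hN; exists c => //; exists b.
pose L := A false `\` N; pose H := ~` A true `|` N.
have mL : measurable L by exact: measurableD.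
have mH : measurable H by apply: measurableU => //; exact: measurableC.
apply/finitely_bracketedP; exists [set bracket L H]; split => //.
  move=> _ ->; exists L, H; split => //.
  apply: (@le_trans _ _ (mu (~` (A false `|` A true) `|` N))).
    apply: le_measure; rewrite ?inE; first exact: measurableD.
      by apply: measurableU => //; apply: measurableC; exact: measurableU.
    move=> x [[Ax|Nx] Lx]; last by right.
    have [Nx|Nx] := pselect (N x); [by right|left].
    by move=> [Afx|//]; exact: Lx.
  rewrite measureU0//; apply: measurableC; exact: measurableU.
move=> c Dc'; exists (bracket L H) => //; split => x.
  move=> [Ax Nx]; apply: contrapT => cx; apply: Nx; exact: (NA false c).
move=> cx; have [Ax|Ax] := pselect (A true x); [right|by left].
exact: (NA true c).
Qed.

(** The families whose complement in [C] is finitely bracketed form a proper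
    filter; any ultrafilter above it avoids every finitely bracketed family. *)
Lemma not_finitely_bracketed_ultra (mu : {measure set T -> \bar R}) eps C :
  ~ finitely_bracketed mu eps C ->
  exists U : set_system (set T), [/\ UltraFilter U, U C &
    forall D, U D -> D `<=` C -> ~ finitely_bracketed mu eps D].
Proof.
move=> nC.
pose F : set_system (set T) := [set D | finitely_bracketed mu eps (C `\` D)].
have FF : ProperFilter F.
  apply: Build_ProperFilter_ex.
    move=> D; rewrite /F/= => FD; apply: contrapT => /forallNP D0; apply: nC.
    apply: finitely_bracketedS FD => c Cc; split => //; exact: D0.
  split.
  - by rewrite /F /= setDT; exact: finitely_bracketed0.
  - by move=> D E FD FE; rewrite /F/= setDIr; exact: finitely_bracketedU.
  - by move=> D E DE; apply: finitely_bracketedS; exact: setDS.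
have [U [UU FU]] := ultraFilterLemma FF.
exists U; split => //.
  by apply: FU; rewrite /F/= setDv; exact: finitely_bracketed0.
move=> D UD DC fD.
have UnD : U (~` D).
  by apply: FU; rewrite /F/= setDE setCK; apply: finitely_bracketedS fD.
have /filter_ex[c []//] : U (D `&` ~` D) by apply: filterI.
Qed.

(** * Splitting sets along the ultrafilter *)

(** Beware of the sign: for [b = true] almost every [c] misses [B], for
    [b = false] almost every [c] contains it, up to null sets. *)
Definition decided (mu : {measure set T -> \bar R})
    (U : set_system (set T)) (b : bool) : set (set T) :=
  [set B | measurable B /\ U [set c | mu.-negligible (B `&` side b c)]].

(** [Y] is what the decided sets of both signs leave uncovered.  If it were null,
    decided sets [A false] and [A true] losing at most [eps / 2] each would leave
    measure at most [eps] between them, and the family [D] that decides both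
    in the same way as almost every [c] would be a finitely bracketed member
    of [U]. *)
Lemma splitting_set (mu : {finite_measure set T -> \bar R}) (eps : R)
    (C : set (set T)) (U : set_system (set T)) :
  0 < eps -> countable C -> UltraFilter U -> U C ->
  (forall D, U D -> D `<=` C -> ~ finitely_bracketed mu eps D) ->
  exists Y, [/\ measurable Y, ~ mu.-negligible Y &
    forall b B, decided mu U b B -> B `<=` Y -> mu.-negligible B].
Proof.
move=> e0 Cc UU UC hU.
have /choice[V hV] b : exists V, [/\ measurable V,
    forall B, decided mu U b B -> mu.-negligible (B `\` V) &
    forall e : R, 0 < e -> exists A, [/\ decided mu U b A, A `<=` V &
      (mu (V `\` A) <= e%:E)%E]].
  apply: ideal_ess_sup.
  - by move=> ? [].
  - split => //; apply: filterS filterT => c _ /=.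
    by rewrite set0I; exact: negligible_set0.
  - move=> A B [mA UA] [mB UB]; split; first exact: measurableU.
    apply: filterS2 UA UB => c /= Ac Bc.
    by rewrite setIUl; exact: negligibleU.
have mV b : measurable (V b) by case: (hV b).
have mY : measurable (~` (V false `|` V true)).
  by apply: measurableC; exact: measurableU.
exists (~` (V false `|` V true)); split => //; last first.
  move=> b B dB BY; have [_ /(_ _ dB) + _] := hV b.
  apply: negligibleS => x Bx; split => // Vx.
  by apply: (BY x Bx); case: b Vx {dB}; [right|left].
move=> /negligibleP-/(_ mY) Y0.
have e20 : 0 < eps / 2 by rewrite divr_gt0.
have /choice[A hA] b : exists A, [/\ decided mu U b A, A `<=` V b &
    (mu (V b `\` A) <= (eps / 2)%:E)%E].
  by have [_ _] := hV b; exact.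
have mA b : measurable (A b) by case: (hA b) => -[].
pose D := C `&` \bigcap_b [set c | mu.-negligible (A b `&` side b c)].
apply: (hU D) => //; last 2 first.
- exact: subIsetl.
- apply: (@finitely_bracketed_decided mu eps D A) => //.
  + by apply: sub_countable Cc; apply: subset_card_le; exact: subIsetl.
  + by move=> b c [_ /(_ b I)].
  apply: (@le_trans _ _ (mu (~` (V false `|` V true) `|`
      ((V false `\` A false) `|` (V true `\` A true))))).
    apply: le_measure; rewrite ?inE.
    + by apply: measurableC; exact: measurableU.
    + by apply: measurableU => //; apply: measurableU; exact: measurableD.
    move=> x nA; have [[Vx|Vx]|] := pselect ((V false `|` V true) x); last by left.
    + by right; left; split => // Ax; apply: nA; left.
    + by right; right; split => // Ax; apply: nA; right.
  have mVA b : measurable (V b `\` A b) by exact: measurableD.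
  apply: le_trans (measureU2 _ _ _) _ => //; first exact: measurableU.
  rewrite Y0 add0e; apply: le_trans (measureU2 _ _ _) _ => //.
  rewrite [eps in leRHS]splitr EFinD; apply: leeD.
    by case: (hA false).
  by case: (hA true).
apply: filterI => //.
have H b : U [set c | mu.-negligible (A b `&` side b c)] by case: (hA b) => -[].
apply: filterS2 (H true) (H false) => c /= h1 h2 [] _ //.
Qed.

(** An undecided set is split by almost every [c], and almost every [c] splits
    finitely many of them at once.  The induction adds one set at a time and
    keeps all atoms non-null inside [Y], so that each of them is again
    undecided. *)
Lemma independent_sets (mu : {measure set T -> \bar R})
    (C : set (set T)) (U : set_system (set T)) (Y : set T) :
  C `<=` measurable -> UltraFilter U -> U C ->
  measurable Y -> ~ mu.-negligible Y ->
  (forall b B, decided mu U b B -> B `<=` Y -> mu.-negligible B) ->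
  forall S : finType, exists c : S -> set T, (forall s, C (c s)) /\
    forall f : {ffun S -> bool}, \bigcap_s side (f s) (c s) !=set0.
Proof.
move=> Cm UU UC mY Y0 hY S.
have mside b c : C c -> measurable (side b c).
  by move=> /Cm mc; case: b => //; exact: measurableC.
suff [c [Cc hc]] : exists c : S -> set T, (forall s, C (c s)) /\
    forall f : {ffun S -> bool}, ~ mu.-negligible
      (Y `&` \bigcap_(s in [set` enum S]) side (f s) (c s)).
  exists c; split => // f; apply/set0P/eqP => f0; apply: (hc f).
  suff -> : [set` enum S] = setT by rewrite f0 setI0; exact: negligible_set0.
  by apply/seteqP; split => // s _ /=; rewrite mem_enum.
elim: (enum S) => [|a l [c [Cc hc]]].
  have [c0 Cc0] := filter_ex UC; exists (fun=> c0); split => // f.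
  by rewrite set_nil bigcap_set0 setIT.
(* Sign patterns on all of [S] index the atoms over [l], with repetitions, by a
   finite type, as the finite intersection property of [U] requires. *)
pose B (f : {ffun S -> bool}) := Y `&` \bigcap_(s in [set` l]) side (f s) (c s).
have mB f : measurable (B f).
  apply: measurableI => //; apply: fin_bigcap_measurable => // s _.
  exact: mside.
have split_B : U [set x | forall fb : {ffun S -> bool} * bool,
    ~ mu.-negligible (B fb.1 `&` side fb.2 x)].
  apply: filter_forall => -[f b] /=.
  have [UB|//] := in_ultra_setVsetC
    [set x | mu.-negligible (B f `&` side b x)] UU.
  by case: (hc f); apply: (hY b (B f)); [split; [exact: mB|]|exact: subIsetl].
have [x [Cx hx]] := filter_ex (filterI UC split_B).
exists (fun s => if s == a then x else c s); split => [s|f].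
  by case: ifP.
move=> h; apply: (hx (f, f a)); apply: negligibleS h => y /= [[Yy By] xy].
split => // s /=; rewrite inE; case: eqP => [->//|_] /= sl.
exact: By.
Qed.

End measure.

Theorem corollary1 (R : realType) (X : completeMetricType R)
    (hsep : separable_space X) (mu : probability (borel X) R)
    (C : set (set (borel X))) (hCm : C `<=` measurable)
    (hCc : countable C) (hCvc : vc_class C) (eps : R) (heps : 0 < eps) :
  bracketing_number eps C mu \is a fin_num.
Proof.
suff [n Cn] : finitely_bracketed mu eps C.
  rewrite ge0_fin_numE; last first.
    by apply: le_ereal_inf_tmp => _ [m _ <-]; rewrite lee_fin.
  apply: le_lt_trans (ltry n%:R).
  by apply: ereal_inf_lbound; exists n.
apply: contrapT => /not_finitely_bracketed_ultra[U [UU UC hU]].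
have [Y [mY Y0 hY]] := splitting_set heps hCc UU UC hU.
have [S hS] := vc_class_dual hCvc.
have [c [Cc hc]] := independent_sets hCm UU UC mY Y0 hY S.
have [f f0] := hS c Cc.
by have := hc f; rewrite f0 => -[].
Qed.
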